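(* Let $n$ be a positive integer. Then $n$ is an odd prime if and only if the number of solutions $(x_1,x_2,x_3,x_4)\in(\mathbb{Z}/n)^4$ to the congruence $$x_1^2+x_2^2+x_3^2+x_4^2\equiv 1\pmod n$$ is equal to $n^3-n$; equivalently, if and only if $$\prod_{\substack{p\mid n\\ p\text{ odd}}}\left(1-\frac1{p^2}\right)^{-1}=\left(1-\frac1{n^2}\right)^{-1},$$ where the product is over the odd prime divisors $p$ of $n$.
   Context: An empty product equals $1$. For $n=1$ the right-hand side of the product equation is undefined and the equation is regarded as not holding. *)

(* Defs.v *)
From mathcomp Require Import all_boot all_order all_algebra.

Set Implicit Arguments.
Unset Strict Implicit.
Unset Printing Implicit Defensive.

(* A class in Z/n is given by its representative in {0, ..., n-1}; ['Z_n] is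
   avoided because ['Z_1] denotes Z/2 and the case n = 1 is meaningful. *)
Definition four_squares_solutions (n : nat) : {set 4.-tuple 'I_n} :=
  [set x : 4.-tuple 'I_n | \sum_(i < 4) tnth x i ^ 2 == 1 %[mod n]].

(* For n = 1 the right-hand side is the inverse of 0, hence undefined, and the
   equation is regarded as false: this is the first conjunct. *)
Definition odd_prime_product_equation (n : nat) : Prop :=
  n <> 1 /\
  (\prod_(p <- primes n | odd p) (1 - 1 / p%:R ^+ 2)^-1
     = (1 - 1 / n%:R ^+ 2)^-1 :> rat)%R.

(* Main.v *)
(* Let N(n) be the number of solutions. By the Chinese remainder theorem N is
   multiplicative. Scaling x by a unit u with u^2 = 1 + p^k mod p^(k+1) shows
   N(p^(k+1)) = p^3 N(p^k) (for p = 2 when k > 2), and N(p) = p^3 - p for p odd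
   because the form is hyperbolic over F_p. So N(n) = n^3 P with P the product of
   1 - 1/p^2 over the odd primes p | n, and both conditions amount to
   P = 1 - 1/n^2. If p | n is an odd prime then P <= 1 - 1/p^2 <= 1 - 1/n^2, so
   equality forces n = p. *)
Require Import Defs.
From mathcomp Require Import all_boot all_order all_algebra.
From mathcomp Require Import ring zify.

Set Implicit Arguments.
Unset Strict Implicit.
Unset Printing Implicit Defensive.

(** * Componentwise counting of tuples; multiplicativity of the count *)

(** Injectivity and equal cardinalities make [x |-> (f x, g x)] a bijection from [A] to [B * C],
    hence one on tuples. It serves both for pairs of remainders and for quotient with remainder. *)
Lemma card_tuple_pair (A B C : finType) (f : A -> B) (g : A -> C) m
    (X : {set m.-tuple B}) (Y : {set m.-tuple C}) :
    injective (fun x => (f x, g x)) -> #|A| = #|B| * #|C| ->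
  #|[set x : m.-tuple A | (map_tuple f x \in X) && (map_tuple g x \in Y)]|
    = #|X| * #|Y|.
Proof.
move=> inj_fg cardA.
pose h (x : m.-tuple A) := (map_tuple f x, map_tuple g x).
have inj_h : injective h.
  move=> x y exy; apply: eq_from_tnth => i; apply: inj_fg; move: exy.
  by move/(congr1 (fun z => (tnth z.1 i, tnth z.2 i))); rewrite /= !tnth_map.
rewrite -cardsX -(on_card_preimset (f := h)).
  by apply: eq_card => x; rewrite !inE.
apply/onW_bij/inj_card_bij => //.
by rewrite card_prod !card_tuple cardA expnMn.
Qed.

Definition sumsq n (x : 4.-tuple 'I_n) : nat := \sum_(i < 4) tnth x i ^ 2.

Definition sumsq_solutions n c : {set 4.-tuple 'I_n} :=
  [set x | sumsq x == c %[mod n]].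

(** The modulus [d] is separate from [n] and [m], so that reduction ([u = 1]) and scaling by a unit
    ([d = n]) are both instances. *)
Lemma sumsq_map n m d (f : 'I_n -> 'I_m) u (x : 4.-tuple 'I_n) :
    (forall i, f i = u * i %[mod d]) ->
  sumsq (map_tuple f x) = u ^ 2 * sumsq x %[mod d].
Proof.
move=> fE; rewrite /sumsq big_distrr /= -modn_summ -[RHS]modn_summ.
congr (_ %% d); apply: eq_bigr => i _.
by rewrite tnth_map -modnXm fE modnXm expnMn.
Qed.

Definition ord_mod n d (d_gt0 : 0 < d) (i : 'I_n) : 'I_d :=
  Ordinal (ltn_pmod i d_gt0).

Lemma sumsq_ord_mod n d (d_gt0 : 0 < d) (x : 4.-tuple 'I_n) :
  sumsq (map_tuple (ord_mod d_gt0) x) = sumsq x %[mod d].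
Proof.
by rewrite (@sumsq_map _ _ d _ 1) ?mul1n // => i; rewrite mul1n modn_mod.
Qed.

Lemma card_four_squares_coprime a b : 0 < a -> 0 < b -> coprime a b ->
  #|four_squares_solutions (a * b)|
    = #|four_squares_solutions a| * #|four_squares_solutions b|.
Proof.
move=> a_gt0 b_gt0 co_ab.
rewrite -(@card_tuple_pair 'I_(a * b) _ _ (ord_mod a_gt0) (ord_mod b_gt0)).
- apply: eq_card => x; rewrite !inE -!/(sumsq _) !sumsq_ord_mod.
  by rewrite chinese_remainder.
- move=> x y [/eqP exa /eqP exb]; apply: val_inj => /=.
  rewrite -(modn_small (ltn_ord x)) -(modn_small (ltn_ord y)).
  by apply/eqP; rewrite chinese_remainder // exa exb.
- by rewrite !card_ord.
Qed.

(** Only the remainder of a coordinate mod [d] affects the congruence, so each of the four quotients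
    is free among [q] values. *)
Lemma card_four_squares_lift q d : 0 < q -> 0 < d ->
  #|[set x : 4.-tuple 'I_(q * d) | sumsq x == 1 %[mod d]]|
    = q ^ 4 * #|four_squares_solutions d|.
Proof.
move=> q_gt0 d_gt0.
have ltq (i : 'I_(q * d)) : i %/ d < q by rewrite ltn_divLR.
have <- : #|[set: 4.-tuple 'I_q]| = q ^ 4 by rewrite cardsT card_tuple card_ord.
rewrite -(@card_tuple_pair 'I_(q * d) _ _ (fun i => Ordinal (ltq i)) (ord_mod d_gt0)).
- by apply: eq_card => x; rewrite !inE -!/(sumsq _) sumsq_ord_mod.
- move=> x y [exa exb]; apply: val_inj => /=.
  by rewrite (divn_eq x d) (divn_eq y d) exa exb.
- by rewrite !card_ord.
Qed.

(** * Lifting solutions from p^k to p^(k+1) *)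

Lemma sumsq_solutions_mod n c c' :
  c = c' %[mod n] -> sumsq_solutions n c = sumsq_solutions n c'.
Proof. by move=> ecc'; apply/setP=> x; rewrite !inE ecc'. Qed.

(** Multiplication by [u] is injective on Z/n. An inequality is enough for a use around a cycle of
    right-hand sides. *)
Lemma card_sumsq_solutions_scale n u c : 0 < n -> coprime u n ->
  #|sumsq_solutions n c| <= #|sumsq_solutions n (u ^ 2 * c)|.
Proof.
move=> n_gt0 co_un.
have fP (i : 'I_n) : u * i %% n < n by rewrite ltn_pmod.
pose f i := Ordinal (fP i).
have inj_f : injective f.
  move=> i j [eij]; apply: val_inj => /=.
  wlog leij : i j eij / i <= j => [sym|].
    by case/orP: (leq_total i j) => [/sym|/sym /esym]; apply.
  move/esym/eqP: eij; rewrite eqn_mod_dvd ?leq_mul2l ?leij ?orbT //.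
  rewrite -mulnBr Gauss_dvdr 1?coprime_sym // -eqn_mod_dvd //.
  by rewrite !modn_small // => /eqP.
have inj_mf : injective (map_tuple (n := 4) f).
  move=> x y exy; apply: eq_from_tnth => i; apply: inj_f; move: exy.
  by move/(congr1 (fun z => tnth z i)); rewrite !tnth_map.
rewrite -(card_imset _ inj_mf); apply/subset_leq_card/subsetP => _ /imsetP[x xc ->].
rewrite !inE in xc *; rewrite (@sumsq_map _ _ n f u) => [|i]; last by rewrite modn_mod.
by rewrite -modnMmr (eqP xc) modnMmr.
Qed.

(* Multiplication by [u] maps the solutions of [Q x = 1 + c p^k] mod [p^k.+1]
   injectively to those of [Q x = 1 + (c+1) p^k]. As [c] is cyclic mod [p], the
   [p] classes into which the solutions mod [p^k] lift all have the same size. *)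
Lemma card_four_squares_Hensel p k u : 1 < p -> 0 < k -> coprime u p ->
    u ^ 2 = 1 + p ^ k %[mod p ^ k.+1] ->
  #|four_squares_solutions (p ^ k.+1)| = p ^ 3 * #|four_squares_solutions (p ^ k)|.
Proof.
move=> p_gt1 k_gt0 co_up u2; have p_gt0 := ltnW p_gt1.
set n := p ^ k.+1; pose R c := #|sumsq_solutions n c|.
have pk_gt1 : 1 < p ^ k by rewrite -{1}(exp1n k) ltn_exp2r.
have n_gt0 : 0 < n by rewrite expn_gt0 p_gt0.
have co_un : coprime u n by rewrite coprimeXr.
have Rle c : R (1 + c * p ^ k) <= R (1 + c.+1 * p ^ k).
  apply: leq_trans (card_sumsq_solutions_scale _ n_gt0 co_un) _.
  rewrite (sumsq_solutions_mod (c' := 1 + c.+1 * p ^ k)) //.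
  have PP : p ^ k * p ^ k = p ^ k.-1 * n.
    by rewrite /n -!expnD; congr (_ ^ _); case: (k) k_gt0 => // m _; lia.
  rewrite -modnMml u2 modnMml.
  have -> : (1 + p ^ k) * (1 + c * p ^ k) = c * (p ^ k * p ^ k) + (1 + c.+1 * p ^ k).
    by ring.
  by rewrite PP mulnA modnMDl.
have Rhomo : {homo (fun c => R (1 + c * p ^ k)) : c d / c <= d}.
  by apply: homo_leq => //; apply: leq_trans.
have R1 c : c < p -> R (1 + c * p ^ k) = R 1.
  move=> ltcp; apply/eqP; rewrite eqn_leq; apply/andP; split; last first.
    by have := Rhomo _ _ (leq0n c); rewrite mul0n addn0.
  (* At c = p the right-hand side is again 1 mod [n], so the monotone chain closes up and is
     constant. *)
  have -> : R 1 = R (1 + p * p ^ k).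
    by rewrite /R (@sumsq_solutions_mod _ (1 + p * p ^ k) 1) // -expnS modnDr.
  exact/Rhomo/ltnW.
(* [W] is counted twice: p^4 lifts of each solution mod p^k, and p classes of size [R 1]. *)
pose W := [set x : 4.-tuple 'I_n | sumsq x == 1 %[mod p ^ k]].
have cardW : #|W| = p ^ 4 * #|four_squares_solutions (p ^ k)|.
  rewrite /W /n expnS card_four_squares_lift // ltnW //.
have ltP (x : 4.-tuple 'I_n) : sumsq x %% n %/ p ^ k < p.
  by rewrite ltn_divLR -?expnS ?ltn_pmod // ltnW.
pose f x := Ordinal (ltP x).
have : #|W| = p * R 1.
  rewrite -sum1_card (partition_big f xpredT) //= -[p in RHS]card_ord -sum_nat_const.
  apply: eq_bigr => c _; rewrite -(R1 c (ltn_ord c)) /R -sum1_card.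
  apply: eq_bigl => x; rewrite !inE -(inj_eq val_inj) /=.
  rewrite -(modn_dvdm _ (dvdn_exp2l p (leqnSn k))) (modn_small pk_gt1).
  have small : 1 + c * p ^ k < n.
    by have := leq_mul2r (p ^ k) c.+1 p; rewrite ltn_ord orbT -expnS -/n mulSn; lia.
  rewrite (modn_small small).
  apply/andP/eqP => [[/eqP rE /eqP qE]|->].
    by rewrite (divn_eq (sumsq x %% n) (p ^ k)) rE qE addnC.
  by rewrite addnC modnMDl modn_small // divnMDl ?divn_small ?addn0 // ltnW.
by rewrite cardW expnS -mulnA => /eqP; rewrite eqn_pmul2l // => /eqP.
Qed.

(** * Counts modulo powers of 2 and of odd primes *)

Lemma card_set_pair (A B : finType) (P : pred (A * B)) :
  #|[set z | P z]| = \sum_a #|[set b | P (a, b)]|.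
Proof.
under eq_bigr do rewrite -sum1_card.
rewrite pair_big_dep -sum1_card.
by apply: eq_big => [[a b]|]; rewrite ?inE.
Qed.

Lemma card_set_tuple4 (T : finType) (P : pred (4.-tuple T)) :
  #|[set x | P x]|
    = #|[set z : (T * T) * (T * T) | P [tuple z.1.1; z.1.2; z.2.1; z.2.2]]|.
Proof.
pose h (z : (T * T) * (T * T)) := [tuple z.1.1; z.1.2; z.2.1; z.2.2].
rewrite -(on_card_preimset (f := h)); first by apply: eq_card => x; rewrite !inE.
apply/onW_bij/inj_card_bij; last by rewrite card_tuple !card_prod; lia.
by move=> [[a b] [c d]] [[a' b'] [c' d']] [-> -> -> ->].
Qed.

(** Nested sums over natural numbers are a form that [vm_compute] can evaluate for small moduli. *)
Lemma card_four_squaresE n :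
  #|four_squares_solutions n| =
    \sum_(0 <= a < n) \sum_(0 <= b < n) \sum_(0 <= c < n) \sum_(0 <= d < n)
      (a ^ 2 + b ^ 2 + c ^ 2 + d ^ 2 == 1 %[mod n]).
Proof.
pose G a b := #|[set v : 'I_n * 'I_n | sumsq [tuple a; b; v.1; v.2] == 1 %[mod n]]|.
transitivity (\sum_a \sum_b G a b).
  by rewrite card_set_tuple4 card_set_pair pair_bigA.
rewrite big_mkord.
apply: eq_bigr => a _; rewrite big_mkord; apply: eq_bigr => b _.
rewrite /G card_set_pair big_mkord; apply: eq_bigr => c _.
rewrite big_mkord -sum1_card big_mkcond; apply: eq_bigr => d _ /=.
by rewrite !inE /sumsq !big_ord_recl big_ord0 addn0 /= !addnA; case: (_ == _).
Qed.

Lemma card_four_squares_pow2 k : #|four_squares_solutions (2 ^ k)| = 8 ^ k.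
Proof.
case: k => [|[|[|k]]].
- by rewrite card_four_squaresE unlock; vm_compute.
- by rewrite card_four_squaresE unlock; vm_compute.
- by rewrite card_four_squaresE unlock; vm_compute.
(* For [p = 2] the number [u = 1 + 2^k.-1] only works for [2 < k], hence the
   computation for the moduli 2, 4 and 8. *)
elim: k => [|k IH].
  by apply/eqP; rewrite card_four_squaresE unlock; vm_compute.
rewrite (@card_four_squares_Hensel _ _ (1 + 2 ^ k.+2)) // ?IH -?expnS //.
  by rewrite coprimen2 /= oddX.
(* The cross term 2 * 2^(k+2) is the wanted 2^(k+3), and 2^(2k+4) is divisible by the modulus
   2^(k+4). *)
have -> : (1 + 2 ^ k.+2) ^ 2 = 2 ^ k * 2 ^ k.+4 + (1 + 2 ^ k.+3).
  by rewrite !expnS expn0; ring.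
by rewrite modnMDl.
Qed.

Lemma card_four_squares_odd_power p k : prime p -> odd p ->
  #|four_squares_solutions (p ^ k.+1)| = (p ^ k) ^ 3 * #|four_squares_solutions p|.
Proof.
move=> p_pr p_odd; elim: k => [|k IH]; first by rewrite mul1n expn1.
(* Half of p + 1 inverts 2 mod p, so the cross term of the square is p^(k+1) mod p^(k+2). *)
rewrite (@card_four_squares_Hensel _ _ (1 + p ^ k.+1 * p.+1./2)) ?prime_gt1 //.
- by rewrite IH mulnA -expnMn -expnS.
- by rewrite expnS -mulnA addnC mulnC coprime_sym /coprime gcdnMDl gcdn1.
have e : 2 * p.+1./2 = p.+1.
  by rewrite mul2n -[RHS]odd_double_half /= p_odd.
have -> : (1 + p ^ k.+1 * p.+1./2) ^ 2
    = (p ^ k * p.+1./2 ^ 2 + 1) * p ^ k.+2 + (1 + p ^ k.+1).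
  transitivity (1 + p ^ k.+1 * (2 * p.+1./2) + p ^ k.+1 * p ^ k.+1 * p.+1./2 ^ 2).
    by ring.
  by rewrite e !expnS; ring.
by rewrite modnMDl.
Qed.

(** * Count over a finite field of odd characteristic *)

Local Open Scope ring_scope.
Import Order.TTheory GRing.Theory Num.Theory.

(** Pigeonhole: the set S of squares exceeds half of [F], so it meets -1 - S. *)
Lemma finField_sum2sq_oppr1 (F : finFieldType) :
  exists a b : F, a ^+ 2 + b ^+ 2 = -1.
Proof.
pose S := [set x ^+ 2 | x : F].
have S0 : 0 \in S by apply/imsetP; exists 0; rewrite ?expr0n.
(* A nonzero square has at most two roots and 0 only one, hence |F| <= 1 + 2(|S| - 1). *)
have cardS : (#|F| < 2 * #|S|)%N.
  have -> : #|F| = (\sum_(s in S) #|[set x : F | x ^+ 2 == s]|)%N.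
    rewrite -sum1_card (partition_big (fun x => x ^+ 2) [in S]) => [|x _]; last first.
      exact: imset_f.
    by apply: eq_bigr => s _; rewrite -sum1_card; apply: eq_bigl => x; rewrite !inE.
  rewrite (bigD1 0) //= (cardsD1 0 S) S0 mulnDr muln1 addSn ltnS.
  apply: leq_add.
    rewrite -(cards1 (0 : F)) subset_leq_card //.
    by apply/subsetP=> x; rewrite !inE expf_eq0.
  rewrite mulnC -sum_nat_const.
  rewrite (eq_bigl [in S :\ 0]); last by move=> s; rewrite !inE andbC.
  apply: leq_sum => s /setD1P[_ /imsetP[r _ ->]].
  have le2 : (#|[set r; - r]| <= 2)%N by rewrite cards2; case: (_ == _).
  apply: leq_trans le2; apply/subset_leq_card/subsetP => x.
  by rewrite !inE eqf_sqr.
pose S' := [set -1 - s | s in S].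
have cardS' : #|S'| = #|S| by apply: card_imset => x y /addrI /oppr_inj.
have : S :&: S' != set0.
  apply: contraL cardS => /eqP e0; rewrite -leqNgt mul2n -addnn -{2}cardS'.
  by rewrite -cardsUI e0 cards0 addn0 max_card.
case/set0Pn => x /setIP[/imsetP[a _ ->] /imsetP[_ /imsetP[b _ ->] e]].
by exists a, b; rewrite e subrK.
Qed.

(** A nonzero coefficient allows solving for its variable; if both vanish, [t != 0] leaves no
    solution. The boolean factor lets a sum over (a, c) count the nonzero pairs. *)
Lemma card_linear2 (F : finFieldType) (a c t : F) : t != 0 ->
  #|[set v : F * F | a * v.1 + c * v.2 == t]| = (((a, c) != (0%R, 0%R)) * #|F|)%N.
Proof.
move=> t_neq0; rewrite xpair_eqE.
have [->|a_neq0] := eqVneq a 0; last first.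
  rewrite mul1n -cardsT
          -[RHS](@card_imset _ _ (fun d => ((t - c * d) / a, d))); last first.
    by move=> x y [_ exy].
  apply: eq_card => -[b d]; rewrite !inE /=; apply/eqP/imsetP => [e | [d' _ [-> ->]]].
    by exists d => //; rewrite -e addrK mulrC mulKf.
  by rewrite mulrC divfK // subrK.
have [->|c_neq0] := eqVneq c 0.
  rewrite mul0n; apply: eq_card0 => v.
  by rewrite !inE !mul0r addr0 eq_sym (negPf t_neq0).
rewrite mul1n -cardsT -[RHS](@card_imset _ _ (fun d => (d, t / c))); last first.
  by move=> x y [exy].
apply: eq_card => -[b d]; rewrite !inE /= mul0r add0r.
apply/eqP/imsetP => [e | [b' _ [_ ->]]].
  by exists b => //; rewrite -e mulrC mulKf.
by rewrite mulrC divfK.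
Qed.

(* Writing [-1 = a^2 + b^2], the last two squares form [-(Z^2 + W^2)], so the
   form is hyperbolic and the equation becomes [A B + C D = 1/4]. *)
Lemma card_four_squares_field (F : finFieldType) : (2 : F) != 0 ->
  #|[set x : 4.-tuple F | \sum_(i < 4) tnth x i ^+ 2 == 1]| = (#|F| ^ 3 - #|F|)%N.
Proof.
move=> two_neq0; have [a [b ab]] := finField_sum2sq_oppr1 F.
rewrite card_set_tuple4.
(* For z = ((A, C), (B, D)) the last two coordinates are those of (a + bi)(Z + Wi), Z = A - B, W = C
   - D, of norm -(Z^2 + W^2). [h'] divides by a + bi, whose inverse is minus its conjugate. *)
pose h (z : (F * F) * (F * F)) :=
  let Z := z.1.1 - z.2.1 in let W := z.1.2 - z.2.2 in
  ((z.1.1 + z.2.1, z.1.2 + z.2.2), (a * Z - b * W, a * W + b * Z)).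
pose h' (y : (F * F) * (F * F)) :=
  let Z := - (a * y.2.1 + b * y.2.2) in let W := - (a * y.2.2 - b * y.2.1) in
  (((y.1.1 + Z) / 2, (y.1.2 + W) / 2), ((y.1.1 - Z) / 2, (y.1.2 - W) / 2)).
have hK : cancel h h'.
  move=> [[A C] [B D]]; rewrite /h /h' /=.
  have -> : a * (a * (A - B) - b * (C - D)) + b * (a * (C - D) + b * (A - B))
     = (a ^+ 2 + b ^+ 2) * (A - B) by ring.
  have -> : a * (a * (C - D) + b * (A - B)) - b * (a * (A - B) - b * (C - D))
     = (a ^+ 2 + b ^+ 2) * (C - D) by ring.
  by rewrite ab; congr ((_, _), (_, _)); field.
rewrite -(on_card_preimset (f := h)); last exact/onW_bij/injF_bij/(can_inj hK).
have q_neq0 : (4 : F)^-1 != 0.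
  by rewrite invr_eq0 (_ : 4 = 2 * 2) ?mulf_neq0 // -natrM.
transitivity #|[set z : (F * F) * (F * F) | z.1.1 * z.2.1 + z.1.2 * z.2.2 == 4^-1]|.
  apply: eq_card => -[[A C] [B D]]; rewrite !inE !big_ord_recl big_ord0 /=.
  rewrite !(tnth_nth 0) /=.
  have -> : (A + B) ^+ 2 + ((C + D) ^+ 2 + ((a * (A - B) - b * (C - D)) ^+ 2
     + ((a * (C - D) + b * (A - B)) ^+ 2 + 0))) =
     (A + B) ^+ 2 + (C + D) ^+ 2 + (a ^+ 2 + b ^+ 2) * ((A - B) ^+ 2 + (C - D) ^+ 2)
    by ring.
  rewrite ab.
  have -> : (A + B) ^+ 2 + (C + D) ^+ 2 + -1 * ((A - B) ^+ 2 + (C - D) ^+ 2)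
    = 4 * (A * B + C * D) by ring.
  rewrite invr_eq0 in q_neq0.
  by rewrite -[in RHS](inj_eq (mulfI q_neq0)) mulfV.
(* For fixed (A, C) the equation is linear in (B, D): each of the q^2 - 1 nonzero pairs gives q
   solutions. *)
rewrite card_set_pair /=.
under eq_bigr => u _ do rewrite card_linear2 // -surjective_pairing.
rewrite -big_distrl /= -big_mkcond /=.
rewrite sum1_card (cardC1 (0, 0)) card_prod.
by rewrite expnS -subn1 mulnBl mul1n expnS expn1 mulnA.
Qed.

Lemma eqr_nat_Fp p m n : prime p ->
  ((m%:R : 'F_p) == n%:R) = (m == n %[mod p]).
Proof. by move=> p_pr; rewrite -(inj_eq (@ord_inj _)) !val_Fp_nat. Qed.

Lemma card_four_squares_prime p : prime p -> odd p ->
  #|four_squares_solutions p| = (p ^ 3 - p)%N.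
Proof.
move=> p_pr p_odd.
have two_neq0 : (2 : 'F_p) != 0.
  by rewrite (eqr_nat_Fp 2 0) // mod0n modn_small ?odd_prime_gt2.
have := card_four_squares_field two_neq0; rewrite card_Fp // => <-.
pose f (i : 'I_p) : 'F_p := (i : nat)%:R.
have inj_f : injective f.
  by move=> i j /eqP; rewrite eqr_nat_Fp // !modn_small // => /eqP /val_inj.
have inj_mf : injective (map_tuple (n := 4) f).
  move=> x y exy; apply: eq_from_tnth => i; apply: inj_f; move: exy.
  by move/(congr1 (fun z => tnth z i)); rewrite !tnth_map.
rewrite -[RHS](on_card_preimset (f := map_tuple (n := 4) f)); last first.
  by apply/onW_bij/inj_card_bij => //; rewrite !card_tuple (card_Fp p_pr) card_ord.
apply: eq_card => x; rewrite !inE.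
have -> : \sum_(i < 4) tnth (map_tuple f x) i ^+ 2
    = (\sum_(i < 4) tnth x i ^ 2)%N%:R :> 'F_p.
  by rewrite natr_sum; apply: eq_bigr => i _; rewrite tnth_map natrX.
by rewrite (eqr_nat_Fp _ 1).
Qed.

(** * Assembly over the prime divisors of n *)

Lemma coprime_multiplicative_primes (f : nat -> nat) n :
    f 1%N = 1%N ->
    (forall a b, 0 < a -> 0 < b -> coprime a b -> f (a * b) = f a * f b)%N ->
    (0 < n)%N ->
  f n = (\prod_(p <- primes n) f (p ^ logn p n))%N.
Proof.
move=> f1 fM n_gt0; rewrite {1}[n]prod_prime_decomp // prime_decompE big_map /=.
have : all prime (primes n) by apply/allP => p; rewrite mem_primes => /andP[].
elim: (primes n) (primes_uniq n) => [|p s IH] /=; first by rewrite !big_nil.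
case/andP=> p_notin s_uniq /andP[p_pr s_pr].
have s_gt0 : (0 < \prod_(q <- s) q ^ logn q n)%N.
  rewrite big_seq; apply: prodn_cond_gt0 => q /(allP s_pr) q_pr.
  by rewrite expn_gt0 prime_gt0.
rewrite !big_cons -IH // fM // ?expn_gt0 ?prime_gt0 //.
rewrite big_seq; elim/big_rec: _ => [|q b q_s co_b]; first exact: coprimen1.
rewrite coprimeMr co_b andbT; apply/coprimeXl/coprimeXr.
rewrite prime_coprime // dvdn_prime2 ?(allP s_pr q q_s) //.
by apply: contraNneq p_notin => ->.
Qed.

Lemma natr_card_four_squares n : (0 < n)%N ->
  #|four_squares_solutions n|%:R
    = n%:R ^+ 3 * \prod_(p <- primes n | odd p) (1 - 1 / p%:R ^+ 2) :> rat.
Proof.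
move=> n_gt0.
rewrite (@coprime_multiplicative_primes (fun m => #|four_squares_solutions m|)) //.
(* The cube n^3 is factored in the same way, so that both sides are compared prime by prime. *)
- rewrite -natrX (@coprime_multiplicative_primes (expn^~ 3%N)) //; last first.
    by move=> a b _ _ _; rewrite expnMn.
  rewrite !natr_prod [X in _ * X]big_mkcond -big_split /=.
  rewrite !big_seq; apply: eq_bigr => p; rewrite mem_primes => /and3P[p_pr _ p_dvd].
  have p_neq0 : p%:R != 0 :> rat by rewrite pnatr_eq0 -lt0n prime_gt0.
  have : (0 < logn p n)%N by rewrite logn_gt0 mem_primes p_pr n_gt0.
  case: (logn p n) => // k _; case: ifP => [p_odd | p_even].
    rewrite card_four_squares_odd_power // card_four_squares_prime //.
    have le_p : (p <= p ^ 3)%N by rewrite -{1}(expn1 p) leq_exp2l ?prime_gt1.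
    rewrite natrM (natrB _ le_p) !natrX [_ ^+ k.+1]exprS; field.
    exact: p_neq0.
  have [->|] := even_prime p_pr; last by rewrite p_even.
  by rewrite card_four_squares_pow2 mulr1 -expnM mulnC expnM.
- exact: (card_four_squares_pow2 0).
- exact: card_four_squares_coprime.
Qed.

Lemma prod_odd_primes_eq n : (0 < n)%N ->
  \prod_(p <- primes n | odd p) (1 - 1 / p%:R ^+ 2) = 1 - 1 / n%:R ^+ 2 :> rat
    <-> prime n /\ odd n.
Proof.
move=> n_gt0; split=> [eqn | [n_pr n_odd]]; last first.
  by rewrite primes_prime // big_mkcond big_seq1 n_odd.
have inv_le (a b : nat) : (0 < a)%N -> (0 < b)%N ->
    ((1 : rat) / a%:R ^+ 2 <= 1 / b%:R ^+ 2) = (b <= a)%N.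
  move=> a_gt0 b_gt0; rewrite !div1r lef_pV2 ?posrE ?exprn_gt0 ?ltr0n //.
  by rewrite ler_pXn2r ?nnegrE ?ler0n // ler_nat.
(* With no odd prime divisor the empty product would force 1/n^2 = 0, which is impossible; this
   includes n = 1. *)
have [/hasP[p p_n p_odd]|no_odd] := boolP (has odd (primes n)); last first.
  move: eqn; rewrite -big_filter (_ : [seq _ <- _ | _] = [::]); last first.
    by apply/eqP; rewrite -[_ == _]negbK -has_filter.
  rewrite big_nil => /eqP; rewrite eq_sym -subr_eq0 addrAC subrr add0r oppr_eq0 div1r.
  by rewrite invr_eq0 expf_eq0 pnatr_eq0 eqn0Ngt n_gt0.
have [p_pr _ p_dvd] : [/\ prime p, (0 < n)%N & p %| n]%N.
  by move: p_n; rewrite mem_primes => /and3P.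
have le_p :
    \prod_(q <- primes n | odd q) (1 - 1 / q%:R ^+ 2) <= 1 - 1 / p%:R ^+ 2 :> rat.
  have bound q : odd q -> 0 <= 1 - 1 / (q%:R : rat) ^+ 2 <= 1.
    move=> q_odd; have q_gt0 : (0 < q)%N by case: q q_odd.
    rewrite subr_ge0 gerBl !div1r invr_ge0 exprn_ge0 ?ler0n // andbT.
    by rewrite invf_le1 ?exprn_gt0 ?ltr0n // exprn_ege1 // ler1n.
  rewrite big_mkcond (bigD1_seq p) ?primes_uniq //= p_odd.
  have /andP[p_ge0 _] := bound p p_odd.
  rewrite ler_piMr // prodr_ile1 // => q _.
  by case: ifP => [/bound|]; rewrite // ler01 lexx.
move: le_p; rewrite eqn lerD2l lerN2 (inv_le p n) ?(prime_gt0 p_pr) // => le_np.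
by have -> : n = p by apply/eqP; rewrite eqn_leq le_np dvdn_leq.
Qed.

Local Close Scope ring_scope.

Theorem corollary2p1 (n : nat) (n_gt0 : 0 < n) :
  (prime n /\ odd n <-> #|four_squares_solutions n| = n ^ 3 - n) /\
  (prime n /\ odd n <-> odd_prime_product_equation n).
Proof.
have n_neq0 : (n%:R != 0 :> rat)%R by rewrite pnatr_eq0 -lt0n.
have prodE := prod_odd_primes_eq n_gt0; split.
  (* This bound makes the subtraction on [nat] exact, so that it carries over to [rat]. *)
  have le_n : n <= n ^ 3 by rewrite -{1}(expn1 n) leq_pexp2l.
  have rhsE : ((n ^ 3 - n)%:R = n%:R ^+ 3 * (1 - 1 / n%:R ^+ 2) :> rat)%R.
    by rewrite (natrB _ le_n) natrX; field.
  rewrite -prodE; split=> [e | e].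
    by apply/eqP; rewrite -(eqr_nat rat) natr_card_four_squares // rhsE e.
  have n3_neq0 : (n%:R ^+ 3 != 0 :> rat)%R by rewrite expf_neq0.
  by apply: (mulfI n3_neq0); rewrite -natr_card_four_squares // e rhsE.
(* Inversion on [rat] is total and injective, so the inverses can be removed; [n <> 1] comes from
   primality. *)
rewrite /odd_prime_product_equation prodfV; split=> [n_odd_pr | [_ /invr_inj /prodE //]].
split; first by case: n_odd_pr => /prime_gt1; case: (n) => [|[]].
by congr (_^-1)%R; apply/prodE.
Qed.
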